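(* Let $p\ge5$ be prime and let $b$ be an integer with $0\le b<p$ satisfying $\left(\dfrac{8b+1}{p}\right)=-1$. Then for every integer $n\ge0$, \[ \overline{p}_{4}(16pn+16b+2)\equiv0\pmod8. \]
   Context: $\left(\frac{\cdot}{p}\right)$ is the Legendre symbol. For $k\ge1$ let $f_k=\prod_{m\ge1}(1-q^{km})$. $\overline{p}_4(n)$ denotes the number of 2-color overpartitions of $n$ (the first occurrence of a part of each color may be overlined) in which one of the two colors appears only in parts that are multiples of $4$; its generating function is $\sum_{n\ge0}\overline{p}_4(n)q^n=\dfrac{f_2f_{8}}{f_1^2f_4^2}$. *)

(* Defs.v *)
From mathcomp Require Import all_boot all_order all_algebra.

Set Implicit Arguments.
Unset Strict Implicit.
Unset Printing Implicit Defensive.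

Definition legendre (a : int) (p : nat) : int :=
  if (p%:Z %| a)%Z then 0%R
  else if [exists x : 'I_p, ((x%:Z ^+ 2)%R == a %[mod p%:Z])%Z] then 1%R
  else (-1)%R.

(* A possible part of a 2-color overpartition of n: (c, i) is the part of
   size i.+1 (so the sizes are 1, ..., n) in color c. *)
Definition cpart (n : nat) : Type := (bool * 'I_n)%type.

Definition part_size n (x : cpart n) : nat := x.2.+1.

(* A 2-color overpartition of n is a pair (m, o): m x is the number of
   occurrences of the colored part x, which is at most n, and o is the set of
   those colored parts whose first occurrence is overlined; a part can only be
   overlined if it occurs.  The color true is the one that appears only in
   parts that are multiples of 4. *)
Definition overpartitions4 (n : nat) :
    {set {ffun cpart n -> 'I_n.+1} * {set cpart n}} :=
  [set mo : {ffun cpart n -> 'I_n.+1} * {set cpart n} |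
     [&& \sum_(x : cpart n) mo.1 x * part_size x == n,
         [forall x in mo.2, 0 < mo.1 x] &
         [forall x : cpart n,
            x.1 && (0 < mo.1 x) ==> (4 %| part_size x)]]].

Definition pbar4 (n : nat) : nat := #|overpartitions4 n|.

(* Main.v *)
(* Summing over the choice of overlined parts, each multiset of coloured parts
   with d distinct parts counts 2^d, so modulo 8 only d = 1 and d = 2 matter.
   Write N = 2 r for the argument of pbar4; here r = 8 (p n + b) + 1 is odd and
   is not a square, being a non-residue modulo p.  The multisets with d = 1
   correspond to the divisors of 2 r, and their number 2 tau(r) is a multiple
   of 4.  Those with d = 2 are even in number: conjugation of partitions acts
   on the monochromatic ones, and for a x + b y = N with 4 | y one swaps a and x
   or, when a = x, replaces (b, y) by (y / 4, 4 b).  A fixed point would give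
   N = b^2 + 2 a b or N = a^2 + 4 b^2, impossible as N = 2 mod 4. *)
Require Import Defs.
From mathcomp Require Import all_boot all_order all_algebra.
From mathcomp Require Import zify.

(** Deleting [x] together with [f x] preserves the three hypotheses, which allows induction on the
    cardinal. *)
Lemma even_card_involution (T : finType) (A : {set T}) (f : T -> T) :
  {in A, forall x, f x \in A} -> {in A, forall x, f (f x) = x} ->
  {in A, forall x, f x != x} -> 2 %| #|A|.
Proof.
have [k] := ubnP #|A|; elim: k A => // k IHk A ltAk fA ffK fne.
have [->|[x xA]] := set_0Vmem A; first by rewrite cards0.
have fxA : f x \in A :\ x by rewrite !inE fne ?fA.
have cardA : #|A| = #|(A :\ x) :\ f x|.+2.
  by rewrite (cardsD1 x A) xA (cardsD1 (f x) (A :\ x)) fxA.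
rewrite cardA dvdn2 /= negbK -dvdn2; apply: IHk.
- by move: ltAk; rewrite cardA; lia.
- move=> y; rewrite !inE => /and3P[yfx yx yA]; rewrite fA // andbT.
  apply/andP; split; first by apply: contraNneq yx => /(congr1 f); rewrite !ffK // => ->.
  by apply: contraNneq yfx => <-; rewrite ffK.
- by move=> y; rewrite !inE => /and3P[_ _ /ffK].
- by move=> y; rewrite !inE => /and3P[_ _ /fne].
Qed.

(** * Reduction modulo 8 to multisets with one or two distinct parts *)

Section Support.

Variable n : nat.
Implicit Types (m : {ffun cpart n -> 'I_n.+1}) (u v z : cpart n).
Implicit Types (x y a b : 'I_n).

Definition psupp m : {set cpart n} := [set x | 0 < m x].

Definition pvalid m : bool :=
  (\sum_(x : cpart n) m x * part_size x == n) &&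
  [forall x : cpart n, x.1 && (0 < m x) ==> (4 %| part_size x)].

Lemma pbar4_sum : pbar4 n = \sum_(m | pvalid m) 2 ^ #|psupp m|.
Proof.
rewrite /pbar4 -sum1_card.
rewrite (eq_bigl (fun mo : {ffun cpart n -> 'I_n.+1} * {set cpart n} =>
  pvalid mo.1 && (mo.2 \subset psupp mo.1))); last first.
  move=> [m o]; rewrite inE /= /pvalid -andbA; congr andb; rewrite andbC.
  congr andb; apply/forall_inP/subsetP => h x xo.
  - by rewrite inE h.
  - by have := h x xo; rewrite inE.
rewrite -(pair_big_dep pvalid (fun m (o : {set cpart n}) => o \subset psupp m) (fun _ _ => 1)) /=.
apply: eq_bigr => m _; rewrite -card_powerset -sum1_card.
by apply: eq_bigl => o; rewrite powersetE.
Qed.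

Lemma pvalidE m : pvalid m =
  (\sum_(x in psupp m) m x * part_size x == n) &&
  [forall x in psupp m, x.1 ==> (4 %| part_size x)].
Proof.
rewrite /pvalid; congr andb.
  rewrite (bigID (mem (psupp m))) /= [X in _ + X]big1 ?addn0 // => x.
  by rewrite inE lt0n negbK => /eqP ->.
by apply: eq_forallb => x; rewrite inE; case: x.1; case: (0 < m x).
Qed.

(* Part sizes and multiplicities are positive, so an ordinal [x : 'I_n]
   encodes the number [x.+1]; [lift ord0 a : 'I_n.+1] has value [a.+1]. *)
Definition one_part u a : {ffun cpart n -> 'I_n.+1} :=
  [ffun z => if z == u then lift ord0 a else ord0].

Definition two_parts u v a b : {ffun cpart n -> 'I_n.+1} :=
  [ffun z => if z == u then lift ord0 a else
             if z == v then lift ord0 b else ord0].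

Lemma psupp_one_part u a : psupp (one_part u a) = [set u].
Proof. by apply/setP => z; rewrite !inE ffunE; case: eqP. Qed.

Lemma psupp_two_parts u v a b : psupp (two_parts u v a b) = [set u; v].
Proof. by apply/setP => z; rewrite !inE ffunE; do 2![case: eqP => //]. Qed.

Lemma psupp_lift m z : z \in psupp m -> {a | m z = lift ord0 a}.
Proof. by rewrite inE; case: (unliftP ord0 (m z)) => [a ->|->] // _; exists a. Qed.

Lemma psupp1_one_part m u : psupp m = [set u] -> exists a, m = one_part u a.
Proof.
move=> supp; have [|a ma] := @psupp_lift m u; first by rewrite supp set11.
exists a; apply/ffunP => z; rewrite ffunE; case: eqP => [->//|/eqP zu].
have: z \notin psupp m by rewrite supp inE.
by rewrite inE lt0n negbK => /eqP mz; apply: val_inj.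
Qed.

Lemma psupp2_two_parts m u v : psupp m = [set u; v] ->
  exists a b, m = two_parts u v a b.
Proof.
move=> supp; have [|a ma] := @psupp_lift m u; first by rewrite supp set21.
have [|b mb] := @psupp_lift m v; first by rewrite supp set22.
exists a, b; apply/ffunP => z; rewrite ffunE; case: eqP => [->//|/eqP zu].
case: eqP => [->//|/eqP zv].
have: z \notin psupp m by rewrite supp !inE negb_or zu.
by rewrite inE lt0n negbK => /eqP mz; apply: val_inj.
Qed.

Lemma two_partsC u v a b : u != v -> two_parts u v a b = two_parts v u b a.
Proof.
move=> uv; apply/ffunP => z; rewrite !ffunE.
by case: (z =P u) => [->|//]; rewrite (negbTE uv).
Qed.

Lemma pvalid_one_part u a : pvalid (one_part u a) =
  (a.+1 * u.2.+1 == n) && (u.1 ==> (4 %| u.2.+1)).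
Proof.
rewrite pvalidE psupp_one_part big_set1 ffunE eqxx; congr andb.
apply/forall_inP/idP => [h|h z /set1P-> //]; exact: (h u (set11 u)).
Qed.

Lemma pvalid_two_parts u v a b : u != v -> pvalid (two_parts u v a b) =
  [&& a.+1 * u.2.+1 + b.+1 * v.2.+1 == n,
      u.1 ==> (4 %| u.2.+1) & v.1 ==> (4 %| v.2.+1)].
Proof.
move=> uv; rewrite pvalidE psupp_two_parts big_setU1 ?inE //= big_set1.
rewrite !ffunE !eqxx (eq_sym v) (negbTE uv); congr andb.
apply/forall_inP/andP => [h|[hu hv] z /set2P[]-> //].
by split; apply: h; rewrite ?set21 ?set22.
Qed.

(** Pairs (multiplicity, part size): the ordered factorizations of [n], as many as [n] has divisors
    when [n] is positive. *)
Definition one_part_data : {set 'I_n * 'I_n} :=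
  [set t : 'I_n * 'I_n | t.1.+1 * t.2.+1 == n].

(* [(c, (x, y), (a, b))]: parts [x.+1] of the unrestricted colour and [y.+1] of
   colour [c], with multiplicities [a.+1] and [b.+1]. *)
Definition two_parts_data : {set bool * ('I_n * 'I_n) * ('I_n * 'I_n)} :=
  [set t : bool * ('I_n * 'I_n) * ('I_n * 'I_n) |
           (t.2.1.+1 * t.1.2.1.+1 + t.2.2.+1 * t.1.2.2.+1 == n) &&
           (if t.1.1 then 4 %| t.1.2.2.+1 else t.1.2.1 < t.1.2.2)].

Hypothesis ndiv4 : ~~ (4 %| n).

(** A single part of the restricted colour has size divisible by 4, which would force 4 to divide
    [n]; so the colour is [false]. *)
Lemma card_support1 :
  #|[set m | pvalid m && (#|psupp m| == 1)]| = #|one_part_data|.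
Proof.
pose f (t : 'I_n * 'I_n) := one_part (false, t.2) t.1.
have finj : injective f.
  move=> [a x] [a' x']; rewrite /f /= => e.
  have := congr1 psupp e; rewrite !psupp_one_part => /set1_inj[xx']; subst x'.
  by have := congr1 (fun m => m (false, x)) e; rewrite !ffunE eqxx => /lift_inj->.
rewrite -(card_imset _ finj); congr #|pred_of_set _|; apply/setP => m.
apply/idP/imsetP => [|[[a x] tD ->]]; rewrite inE.
  case/andP => vm /cards1P[[c x] supp]; have [a ma] := psupp1_one_part _ _ supp.
  move: vm; rewrite ma pvalid_one_part /= => /andP[/eqP e].
  case: c ma {supp} => /= [_ d|ma _].
    by case/negP: ndiv4; rewrite -e dvdn_mull.
  by exists (a, x); rewrite ?inE /= ?e.
by move: tD; rewrite /f pvalid_one_part psupp_one_part cards1 inE eqxx => ->.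
Qed.

(** Two restricted parts would force 4 to divide [n], so one part always has colour [false]. If both
    do, ordering the sizes makes the encoding unique; if the other has colour [true], the colours
    tell the parts apart and the sizes may coincide. *)
Lemma card_support2 :
  #|[set m | pvalid m && (#|psupp m| == 2)]| = #|two_parts_data|.
Proof.
pose f (t : bool * ('I_n * 'I_n) * ('I_n * 'I_n)) :=
  two_parts (false, t.1.2.1) (t.1.1, t.1.2.2) t.2.1 t.2.2.
have dist (t : bool * ('I_n * 'I_n) * ('I_n * 'I_n)) : t \in two_parts_data ->
    (false, t.1.2.1) != (t.1.1, t.1.2.2).
  rewrite inE => /andP[_]; case: t.1.1 => // lt.
  by apply: contraTneq lt => [[->]]; rewrite ltnn.
have finj : {in two_parts_data &, injective f}.
  move=> [[c [x y]] [a b]] [[c' [x' y']] [a' b']] tD tD'; rewrite /f /= => e.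
  have [neq neq'] := (dist _ tD, dist _ tD'); rewrite /= in neq neq'.
  have := congr1 psupp e; rewrite !psupp_two_parts /= => esupp.
  have [ex ey] : (false, x) = (false, x') /\ (c, y) = (c', y').
    have := set21 (false, x) (c, y); rewrite esupp => /set2P[ex|ex];
    have := set22 (false, x) (c, y); rewrite esupp => /set2P[ey|ey] //.
    - by rewrite ex ey eqxx in neq.
    (* In this crossed match both colours are [false], and the orders [x < y] and [x' < y']
       contradict each other. *)
    - move: tD tD'; rewrite !inE /=; case: ex ey => <- -> [-> ->] /=.
      by case/andP=> _ ? /andP[_ ?]; lia.
    - by rewrite ex ey eqxx in neq.
  case: ex ey => ? [? ?]; subst x' c' y'.
  have := congr1 (fun m => m (false, x)) e; rewrite !ffunE eqxx => /lift_inj->.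
  have := congr1 (fun m => m (c, y)) e; rewrite !ffunE eqxx (eq_sym (c, y)) (negbTE neq).
  by move=> /lift_inj->.
rewrite -(card_in_imset finj); congr #|pred_of_set _|; apply/setP => m.
apply/idP/imsetP => [|[[[c [x y]] [a b]] tD ->]]; last first.
  have neq := dist _ tD; rewrite inE psupp_two_parts cards2 neq eqxx andbT.
  rewrite pvalid_two_parts //=; move: tD; rewrite inE /= => /andP[->].
  by case: c {neq}.
rewrite inE => /andP[vm /cards2P[[c x] [[d y] [neq supp]]]].
have [a [b ma]] := psupp2_two_parts _ _ _ supp.
move: vm; rewrite ma pvalid_two_parts //= => /and3P[e hc hd].
move: neq hc hd {ma supp}; case: c; case: d => /= neq hc hd.
- by case/negP: ndiv4; rewrite -(eqP e) dvdn_add ?dvdn_mull.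
- exists (true, (y, x), (b, a)); first by rewrite inE /= hc addnC e.
  by rewrite two_partsC.
- by exists (true, (x, y), (a, b)); first by rewrite inE /= hd e.
have [lt|lt|exy] := ltngtP x y.
- by exists (false, (x, y), (a, b)); first by rewrite inE /= lt e.
- exists (false, (y, x), (b, a)); first by rewrite inE /= lt addnC e.
  by rewrite two_partsC.
by move: neq; rewrite (val_inj exy) eqxx.
Qed.

Lemma sum_support_card k :
  \sum_(m | pvalid m && (#|psupp m| == k)) 2 ^ #|psupp m| =
    2 ^ k * #|[set m | pvalid m && (#|psupp m| == k)]|.
Proof.
rewrite mulnC -sum_nat_const; apply: eq_big => [m|m /andP[_ /eqP-> //]].
by rewrite inE.
Qed.

Lemma pbar4_mod8 :
  pbar4 n = 2 * #|one_part_data| + 4 * #|two_parts_data| %[mod 8].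
Proof.
rewrite -card_support1 -card_support2 -(sum_support_card 1) -(sum_support_card 2).
rewrite pbar4_sum (bigID (fun m => #|psupp m| == 1)) /=.
rewrite [X in _ + X](bigID (fun m => #|psupp m| == 2)) /= addnA.
set A := \sum_(m | _ && (#|psupp m| == 1)) _.
have -> : \sum_(m | pvalid m && (#|psupp m| != 1) && (#|psupp m| == 2))
    2 ^ #|psupp m| = \sum_(m | pvalid m && (#|psupp m| == 2)) 2 ^ #|psupp m|.
  by apply: eq_bigl => m; rewrite -andbA; case: eqP => // ->.
set B := \sum_(m | pvalid m && (#|psupp m| == 2)) _.
rewrite -modnDmr; set C := \sum_(m | _ && (#|psupp m| != 2)) _.
suff /eqP-> : 8 %| C by rewrite addn0.
apply: dvdn_sum => m /andP[/andP[vm ne1] ne2]; apply: (@dvdn_exp2l 2 3).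
(* The support has at least three elements unless it is empty, and then [n] is 0, a multiple of
   4. *)
case: (posnP #|psupp m|) => [/eqP|]; last first.
  by move: ne1 ne2; case: #|psupp m| => [|[|[|]]].
rewrite cards_eq0 => /eqP supp.
move: vm; rewrite pvalidE supp big_set0 => /andP[/eqP n0].
by move: ndiv4; rewrite -n0.
Qed.

End Support.

(** * Parity of the number of multisets with two distinct parts *)

Lemma sqr_mod4 u v : (u * u + 2 * (u * v)) %% 4 <> 2.
Proof.
rewrite -modnDm -(modnMm u u) -(modnMmr 2) -(modnMm u v).
(* An odd [u] makes the sum odd, an even [u] makes it a multiple of 4. *)
case: (u %% 4) (ltn_pmod u (isT : 0 < 4)) => [|[|[|[|]]]] // _;
by case: (v %% 4) (ltn_pmod v (isT : 0 < 4)) => [|[|[|[|]]]].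
Qed.

Lemma even_two_parts_data k : k.+1 %% 4 = 2 -> 2 %| #|two_parts_data k.+1|.
Proof.
move=> kmod.
pose f (t : bool * ('I_k.+1 * 'I_k.+1) * ('I_k.+1 * 'I_k.+1)) :=
  let: (c, (x, y), (a, b)) := t in
  if c then
    (* [4 * b + 3] encodes the part size 4(b+1), and the new multiplicity is a quarter of the old
       part size. *)
    if a == x then (true, (x, inord (4 * b + 3)), (a, inord (y.+1 %/ 4).-1))
    else (true, (a, y), (x, b))
  (* Conjugation: A copies of X and B copies of Y, with X < Y, become Y-X copies of B and X copies
     of A+B. *)
  else (false, (b, inord (a + b.+1)), (inord (y - x.+1), x)).
(* Out of range [inord] would return [ord0]; [bound] and [bound4] rule this out. *)
have bound (x y a b : 'I_k.+1) : a.+1 * x.+1 + b.+1 * y.+1 = k.+1 ->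
    x < y -> a + b.+1 < k.+1 /\ y - x.+1 < k.+1.
  move=> e xy; split; last by have := ltn_ord y; lia.
  have := leq_pmulr a.+1 (ltn0Sn x).
  have := leq_mul (leqnn b.+1) (leq_ltn_trans (leq0n x) xy : 0 < y); lia.
have bound4 (x y a b : 'I_k.+1) : a.+1 * x.+1 + b.+1 * y.+1 = k.+1 ->
    4 %| y.+1 -> (4 * b + 3) < k.+1 /\ (y.+1 %/ 4).-1 < k.+1.
  move=> e /dvdnP[d yd]; split; last by have := ltn_ord y; lia.
  by case: d yd => // d yd; move: e; rewrite yd; lia.
(* Each of the three conditions on [f] is split by the second colour: first restricted, then
   unrestricted. *)
apply: (@even_card_involution _ _ f) => [] [[[] [x y]] [a b]];
  rewrite inE /= => /andP[/eqP e h].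
- have [lt1 lt2] := bound4 _ _ _ _ e h.
  case: eqP => [ax|_]; rewrite inE /=; last by rewrite h andbT; lia.
  rewrite !inordK //; move: h e => /dvdnP[d yd]; subst a.
  case: d yd => // d yd; rewrite yd mulnK //= -addnS -mulnSr dvdn_mulr // andbT.
  by move=> e; apply/eqP; lia.
- have [lt1 lt2] := bound _ _ _ _ e h.
  rewrite inE /= !inordK //; apply/andP; split; last by lia.
  (* This replaces the truncated subtraction [y - x.+1] by [z]. *)
  have [z yz] : {z : nat | y = x + z.+1 :> nat} by exists (y - x.+1); lia.
  by move: e; rewrite yz; lia.
- have [lt1 lt2] := bound4 _ _ _ _ e h.
  case: eqP => [ax|/eqP ax] /=; last by rewrite eq_sym (negbTE ax).
  subst a; rewrite eqxx; congr (_, (_, _), (_, _)); apply: val_inj => /=;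
  by have [d yd] := dvdnP h; rewrite !inordK //; lia.
- have [lt1 lt2] := bound _ _ _ _ e h.
  congr (_, (_, _), (_, _)); apply: val_inj => /=;
  by have := (ltn_ord y, ltn_ord a); rewrite ?inordK //; lia.
- have [lt1 lt2] := bound4 _ _ _ _ e h.
  case: (a =P x) => [ax|ax]; last first.
    by apply/negP => /eqP[/ax].
  apply/negP => /eqP[/(congr1 val) /= eb _]; move: eb; rewrite inordK //.
  have [d yd] := dvdnP h; move: e; rewrite ax yd => e _.
  (* Here [k.+1] is (x+1)^2 + 4(b+1)^2, a square modulo 4. *)
  by apply: (@sqr_mod4 x.+1 0); lia.
- have [lt1 lt2] := bound _ _ _ _ e h.
  apply/negP => /eqP[/(congr1 val) /= ex /(congr1 val) /= ey _ _]; move: ey.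
  rewrite inordK // => ey; apply: (@sqr_mod4 b.+1 a.+1).
  by move: e; rewrite -ex -ey; lia.
Qed.

(** * The number of divisors of 2r modulo 4 *)

Lemma odd_factor_mod4 u v : u * v %% 4 = 2 -> odd u = ~~ odd v.
Proof.
rewrite -modnMml -modnMmr -(odd_mod u (erefl : odd 4 = false)).
rewrite -(odd_mod v (erefl : odd 4 = false)).
case: (u %% 4) (ltn_pmod u (isT : 0 < 4)) => [|[|[|[|]]]] // _;
by case: (v %% 4) (ltn_pmod v (isT : 0 < 4)) => [|[|[|[|]]]].
Qed.

(** Exactly one factor is odd, and swapping the factors shows that the odd one comes first in half
    of the pairs. These pairs correspond to factorizations of [r], whose number is even because
    exchanging the two factors fixes none when [r] is not a square. *)
Lemma card_one_part_data_mod4 k r : k.+1 = 2 * r -> odd r ->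
  (forall s, r <> s ^ 2) -> 4 %| #|one_part_data k.+1|.
Proof.
move=> kr oddr nsq; set D := one_part_data k.+1.
have kmod : k.+1 %% 4 = 2 by lia.
pose D1 := [set t : 'I_k.+1 * 'I_k.+1 | (t \in D) && odd t.1.+1].
pose swap (t : 'I_k.+1 * 'I_k.+1) := (t.2, t.1).
have swapK : involutive swap by case.
have -> : #|D| = 2 * #|D1|.
  rewrite -(cardsID [set t : 'I_k.+1 * 'I_k.+1 | odd t.1.+1] D).
  have -> : D :&: [set t : 'I_k.+1 * 'I_k.+1 | odd t.1.+1] = D1.
    by apply/setP => t; rewrite !inE.
  rewrite mul2n -addnn; congr addn.
  rewrite -(card_imset _ (inv_inj swapK)); congr #|pred_of_set _|.
  apply/setP => t; rewrite -{1}(swapK t) (mem_imset _ _ (inv_inj swapK)) !inE.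
  rewrite [t.1.+1 * _]mulnC andbC; case: eqP => //= e.
  by rewrite -[~~ odd t.2]/(odd t.2.+1) (@odd_factor_mod4 t.2.+1 t.1.+1) ?e ?negbK.
rewrite (@dvdn_mul 2 2) //.
(* On actual factors this sends (A, 2Z) to (Z, 2A), where AZ = r. *)
pose f (t : 'I_k.+1 * 'I_k.+1) : 'I_k.+1 * 'I_k.+1 :=
  (inord (t.2.+1 %/ 2).-1, inord (2 * t.1 + 1)).
have half (a x : 'I_k.+1) : a.+1 * x.+1 = k.+1 -> odd a.+1 ->
  exists z, [/\ x.+1 = 2 * z.+1, a.+1 * z.+1 = r,
                2 * a + 1 < k.+1, z < k.+1 & odd z.+1].
  move=> e od; have /dvdnP[z xz] : 2 %| x.+1.
    by rewrite dvdn2 -(@odd_factor_mod4 a.+1) ?e.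
  case: z xz => // z xz; exists z.
  have az : a.+1 * z.+1 = r by move: e; rewrite xz; lia.
  split=> //; first by rewrite mulnC.
  - by have := leq_pmulr a.+1 (ltn0Sn z); lia.
  - by have := ltn_ord x; lia.
  - by move: oddr; rewrite -az oddM => /andP[].
apply: (@even_card_involution _ _ f) => -[a x]; rewrite !inE /= => /andP[/eqP e od].
all: have [z [xz az lt1 lt2 oz]] := half _ _ e od.
all: rewrite /f /= xz mulKn //=.
- rewrite !inordK //; apply/andP; split; last by exact: oz.
  by apply/eqP; move: e; rewrite xz; lia.
- congr (_, _); apply: val_inj; rewrite /= !inordK //; lia.
- apply/eqP => -[/(congr1 val) /= ea _]; case: (nsq a.+1).
  by move: ea; rewrite inordK // -az => ->; lia.
Qed.

Lemma pbar4_dvd8 r : odd r -> (forall s, r <> s ^ 2) -> 8 %| pbar4 (2 * r).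
Proof.
case: r => // r oddr nsq.
have kmod : (2 * r.+1) %% 4 = 2 by lia.
have ndiv : ~~ (4 %| 2 * r.+1) by lia.
rewrite /dvdn pbar4_mod8 //.
have [k kr] : {k | 2 * r.+1 = k.+1} by exists (2 * r.+1).-1; lia.
rewrite kr in kmod *.
have /dvdnP[u ->] := even_two_parts_data _ kmod.
have /dvdnP[v ->] := card_one_part_data_mod4 _ _ (esym kr) oddr nsq.
lia.
Qed.

Theorem theorem4p2 (p b : nat) (hp : prime p) (hp5 : 5 <= p) (hb : b < p)
    (hleg : legendre (8 * b + 1)%N%:Z p = (-1)%R) (n : nat) :
  pbar4 (16 * p * n + 16 * b + 2) = 0 %[mod 8].
Proof.
have -> : 16 * p * n + 16 * b + 2 = 2 * (8 * (p * n + b) + 1) by lia.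
rewrite mod0n; apply/eqP; apply: pbar4_dvd8; first by lia.
(* If the odd factor were [s ^ 2], then [s %% p] would be a square root of 8b+1 modulo [p], so the
   symbol could not be -1. *)
move=> s es; move: hleg; rewrite /legendre; case: ifP => // _.
case: ifP => // /existsP[].
have lt_s : s %% p < p by rewrite ltn_mod prime_gt0.
exists (Ordinal lt_s) => /=.
rewrite GRing.expr2 -PoszM !modz_nat; apply/eqP; congr Posz.
rewrite modnMml modnMmr mulnn -es.
have -> : 8 * (p * n + b) + 1 = 8 * n * p + (8 * b + 1) by lia.
by rewrite modnMDl.
Qed.
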